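(* Let $m$ and $n$ be positive integers larger than $1$. Then for every $m$-homogeneous polynomial $\sum_{|\alpha|=m} a_\alpha z^\alpha$ on $\mathbb{C}^n$ (with complex coefficients $a_\alpha$) we have \[ \Bigl( \sum_{|\alpha| = m} |a_\alpha|^{\frac{2m}{m+1}} \Bigr)^{\frac{m+1}{2m}} \leq \Bigl(1+\frac{1}{m-1}\Bigr)^{m-1}\sqrt{m}\, (\sqrt{2})^{m-1} \sup_{z \in \mathbb{D}^n} \Bigl|\sum_{|\alpha| = m} a_\alpha z^\alpha\Bigr| . \]
   Context: $\mathbb{D}^n=\{z\in\mathbb{C}^n: |z_k|<1,\ k=1,\dots,n\}$ is the open unit polydisc. Multi-index notation is used: $\alpha=(\alpha_1,\dots,\alpha_n)$ ranges over $n$-tuples of non-negative integers, $|\alpha|=\alpha_1+\cdots+\alpha_n$, and $z^\alpha=z_1^{\alpha_1}\cdots z_n^{\alpha_n}$. *)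

(* Defs.v *)
(* MathComp and MathComp-Analysis. The notations of mpoly clash with those of
   MathComp-Analysis, so only its coercions and canonical structures are
   imported, and its constants are written with qualified names. *)
From mathcomp Require Import all_boot all_order all_algebra.
From mathcomp Require Import all_classical all_reals all_analysis.
From mathcomp Require Import complex.
From mathcomp Require Import (coercions, canonicals) mpoly.

Set Implicit Arguments.
Unset Strict Implicit.
Unset Printing Implicit Defensive.

Import GRing.Theory Num.Theory.
Local Open Scope classical_set_scope.
Local Open Scope ring_scope.
Local Open Scope complex_scope.

Definition polydisc (R : realType) (n : nat) : set ('I_n -> R[i]) :=
  [set z | forall k, Normc.normc (z k) < 1].
Arguments polydisc : clear implicits.

(* The set is nonempty and bounded above, since |p(z)| is at most the sum of
   the moduli of the coefficients of p on the polydisc; so [sup] is the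
   genuine least upper bound, never its default value. *)
Definition polydisc_sup (R : realType) (n : nat) (p : mpoly.mpoly n R[i]) : R :=
  sup [set Normc.normc (mpoly.meval z p) | z in polydisc R n].

(* Main.v *)
(* Proof idea (Defant, Frerick, Ortega-Cerda, Ounaies and Seip).
   Write P(z) as a sum over m-tuples i of c_i z_{i_1} ... z_{i_m} with c
   symmetric, and let |i| be the number of rearrangements of i. Blei's
   inequality bounds the l^{2m/(m+1)} norm of |i|^{1/2} c_i, which dominates
   the left-hand side, by the sum over k of the l^2 norms of its slices with
   one index equal to k. Up to sqrt m, these are the l^2 norms of the
   coefficients of P_k = (dP/dz_k) / m. By hypercontractivity, each is at most
   sqrt 2 ^ (m - 1) times the mean of |P_k| over the torus; and pointwise the
   sum of the |P_k| is at most (1 + 1/(m-1))^(m-1) sup |P|, by Cauchy's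
   estimate for the coefficient of t in P(z + t w) on |t| = 1/(m-1).
   All means are finite averages over N-th roots of unity. For a fixed degree,
   hypercontractivity then holds up to a factor 1 + e when N is large, and
   e tends to 0 at the end. In one variable, reflecting the roots of F that
   lie in the disc keeps |F| on the circle and increases it inside, so F may
   be taken to be c (1 - w_1 x) ... (1 - w_d x) with |w_i| <= 1. It is then
   nearly c h^2 for a polynomial h, and Cauchy-Schwarz on the coefficients of
   h^2 concludes. *)
Require Import Defs.
From mathcomp Require Import all_boot all_order all_algebra.
From mathcomp Require Import all_classical all_reals all_analysis.
From mathcomp Require Import complex.
From mathcomp Require Import (coercions, canonicals) mpoly.
From mathcomp Require Import perm separable cyclic cyclotomic.
From mathcomp Require Import ring lra zify.

Set Implicit Arguments.
Unset Strict Implicit.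
Unset Printing Implicit Defensive.

Import Order.TTheory GRing.Theory Num.Theory Normc.
Local Open Scope ring_scope.
Local Open Scope complex_scope.

(** * Finite inequalities *)

Lemma sum_tuple_cons (V : nmodType) (T : finType) n (F : n.+1.-tuple T -> V) :
  \sum_t F t = \sum_x \sum_(t : n.-tuple T) F [tuple of x :: t].
Proof.
rewrite pair_bigA /=.
rewrite (reindex (fun p : T * n.-tuple T => [tuple of p.1 :: p.2])) //=.
exists (fun t => (thead t, [tuple of behead t])) => [[x t] _ | t _] /=.
  by rewrite theadE; congr pair; apply: val_inj.
by rewrite -tuple_eta.
Qed.

Lemma sum_tuple0 (V : nmodType) (T : finType) (F : 0.-tuple T -> V) :
  \sum_t F t = F [tuple].
Proof. by apply: big_pred1 => t /=; rewrite tuple0; apply/esym/eqP. Qed.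

(** Cauchy-Schwarz: the nonnegative sum of the squares [(G * f i - B * g i) ^+ 2] expands to
    [G * (A * G - B ^+ 2)], and [G] divides out unless [g] vanishes. *)
Lemma sum_mul_le_sqrt (R : rcfType) (I : finType) (f g : I -> R) :
  \sum_i f i * g i <= Num.sqrt (\sum_i f i ^+ 2) * Num.sqrt (\sum_i g i ^+ 2).
Proof.
set A := \sum_i f i ^+ 2; set B := \sum_i f i * g i; set G := \sum_i g i ^+ 2.
have A0 : 0 <= A by apply: sumr_ge0 => i _; exact: sqr_ge0.
have G0 : 0 <= G by apply: sumr_ge0 => i _; exact: sqr_ge0.
rewrite -sqrtrM //; apply: (le_trans (ler_norm _)); rewrite -sqrtr_sqr.
apply: ler_wsqrtr.
have : 0 <= \sum_i (G * f i - B * g i) ^+ 2.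
  by apply: sumr_ge0 => i _; exact: sqr_ge0.
rewrite (eq_bigr (fun i => G ^+ 2 * f i ^+ 2 - 2 * G * B * (f i * g i)
  + B ^+ 2 * g i ^+ 2)); last by move=> i _; ring.
rewrite big_split /= sumrB -!mulr_sumr -/A -/B -/G.
rewrite (_ : _ - _ + _ = G * (A * G - B ^+ 2)); last by ring.
have [G00|Gn0] := eqVneq G 0.
  have /psumr_eq0P g0 : \sum_i g i ^+ 2 = 0 by [].
  have -> : B = 0; last by move=> _; rewrite expr0n /= mulr_ge0.
  rewrite /B big1 // => i _.
  have /eqP := g0 (fun i _ => sqr_ge0 (g i)) i isT.
  by rewrite expf_eq0 /= => /eqP ->; rewrite mulr0.
have Gp : 0 < G by rewrite lt_neqAle G0 andbT eq_sym.
by rewrite pmulr_rge0 // subr_ge0.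
Qed.

(** Minkowski's inequality by duality: [S] is the sum over [j] of the inner products of [f _ j] with
    [g], each bounded by Cauchy-Schwarz; then [Num.sqrt S] divides out. *)
Lemma minkowski_sum (R : rcfType) (I J : finType) (f : I -> J -> R) :
  Num.sqrt (\sum_i (\sum_j f i j) ^+ 2) <=
  \sum_j Num.sqrt (\sum_i f i j ^+ 2).
Proof.
set S := \sum_i (\sum_j f i j) ^+ 2; pose g i := \sum_j f i j.
have S0 : 0 <= S by apply: sumr_ge0 => i _; exact: sqr_ge0.
have := sqrtr_ge0 S; rewrite le_eqVlt => /orP[/eqP <-|Sp].
  by apply: sumr_ge0 => j _; exact: sqrtr_ge0.
rewrite -(ler_pM2r Sp) -expr2 sqr_sqrtr // mulr_suml.
rewrite [leLHS](_ : S = \sum_j \sum_i f i j * g i); last first.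
  rewrite exchange_big /=; apply: eq_bigr => i _.
  by rewrite -mulr_suml expr2.
by apply: ler_sum => j _; exact: sum_mul_le_sqrt.
Qed.

Lemma sqrt_sum_sqrD (R : rcfType) (I : finType) (f g : I -> R) :
  Num.sqrt (\sum_i (f i + g i) ^+ 2) <=
  Num.sqrt (\sum_i f i ^+ 2) + Num.sqrt (\sum_i g i ^+ 2).
Proof.
have := minkowski_sum (fun i (b : bool) => if b then f i else g i).
rewrite big_bool /=; congr (Num.sqrt _ <= _).
by apply: eq_bigr => i _; rewrite big_bool.
Qed.

(** Weighted AM-GM, obtained by averaging [ln x <= x - 1] at the points [x = s j / M]. *)
Lemma prod_powR_le_sum (R : realType) (J : finType) (a t : J -> R) :
  (forall j, 0 <= a j) -> \sum_j a j = 1 -> (forall j, 0 <= t j) ->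
  \prod_j t j `^ a j <= \sum_j a j * t j.
Proof.
move=> a0 a1 t0.
have M0 : 0 <= \sum_j a j * t j by apply: sumr_ge0 => j _; exact: mulr_ge0.
have [/existsP[j /andP[/eqP tj aj]]|/existsPn h] :=
    boolP [exists j, (t j == 0) && (a j != 0)].
  by rewrite (bigD1 j) //= tj powR0 // mul0r.
(* Where the weight vanishes the value of [t j] does not matter; 1 replaces it so that every
   logarithm is taken at a positive number. *)
pose s j := if a j == 0 then 1 else t j.
have sp j : 0 < s j.
  rewrite /s; case: ifPn => // aj; rewrite lt_neqAle t0 andbT eq_sym.
  by have := h j; rewrite aj andbT.
have -> : \prod_j t j `^ a j = \prod_j s j `^ a j.
  by apply: eq_bigr => j _; rewrite /s; case: eqP => // ->; rewrite !powRr0.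
have EM : \sum_j a j * t j = \sum_j a j * s j.
  by apply: eq_bigr => j _; rewrite /s; case: eqP => // ->; rewrite !mul0r.
rewrite EM in M0 *; set M := \sum_j _ in M0 *.
have Mp : 0 < M.
  rewrite lt_neqAle M0 andbT eq_sym; apply/negP => /eqP Me.
  have /psumr_eq0P z : \sum_j a j * s j = 0 by [].
  have : \sum_j a j = 0.
    apply: big1 => j _.
    have /eqP := z (fun j _ => mulr_ge0 (a0 j) (ltW (sp j))) j isT.
    by rewrite mulf_eq0 (gt_eqF (sp j)) orbF => /eqP.
  by rewrite a1 => /eqP; rewrite oner_eq0.
have -> : \prod_j s j `^ a j = expR (\sum_j a j * ln (s j)).
  by rewrite expR_sum; apply: eq_bigr => j _; rewrite /powR (gt_eqF (sp j)).
rewrite -[leRHS]lnK ?posrE // ler_expR.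
rewrite -subr_le0 -[ln M]mul1r -{1}a1 mulr_suml -sumrB.
rewrite [leRHS](_ : 0 = \sum_j a j * (s j / M - 1)); last first.
  apply/esym.
  under eq_bigr => j _ do rewrite mulrBr mulr1 mulrA.
  by rewrite sumrB -mulr_suml -/M a1 divff ?subrr // gt_eqF.
apply: ler_sum => j _; rewrite -mulrBr ler_wpM2l //.
have sMp : 0 < s j / M by rewrite divr_gt0.
rewrite -ln_div ?posrE // -[in leLHS](subrK 1 (s j / M)) addrC.
by apply: le_ln1Dx; rewrite ltrBrDl subrr.
Qed.

(** Once each [f j] is divided by its sum, weighted AM-GM holds pointwise, and summing over [i]
    gives total weight 1. *)
Lemma hoelder_sum (R : realType) (I J : finType) (a : J -> R) (f : J -> I -> R) :
  (forall j, 0 <= a j) -> \sum_j a j = 1 -> (forall j i, 0 <= f j i) ->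
  \sum_i \prod_j f j i `^ a j <= \prod_j (\sum_i f j i) `^ a j.
Proof.
move=> a0 a1 f0; pose F j := \sum_i f j i.
have F0 j : 0 <= F j by apply: sumr_ge0.
have [/existsP[j /andP[/eqP Fj aj]]|/existsPn h] :=
    boolP [exists j, (F j == 0) && (a j != 0)].
  rewrite [leRHS](_ : _ = 0); last by rewrite (bigD1 j) //= -/(F j) Fj powR0 // mul0r.
  rewrite big1 // => i _; rewrite (bigD1 j) //=.
  have /psumr_eq0P -> // : \sum_i f j i = 0 by [].
  by rewrite powR0 // mul0r.
pose G j := if a j == 0 then 1 else F j.
have Gp j : 0 < G j.
  rewrite /G; case: ifPn => // aj; rewrite lt_neqAle F0 andbT eq_sym.
  by have := h j; rewrite aj andbT.
have P0 : 0 < \prod_j G j `^ a j by apply: prodr_gt0 => j _; exact: powR_gt0.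
have -> : \prod_j (\sum_i f j i) `^ a j = \prod_j G j `^ a j.
  apply: eq_bigr => j _; rewrite /G; case: eqP => // ->.
  by rewrite !powRr0.
rewrite -[leRHS]mul1r -ler_pdivrMr // mulr_suml.
apply: (@le_trans _ _ (\sum_i \sum_j a j * (f j i / G j))).
  apply: ler_sum => i _; rewrite -prodf_div.
  rewrite (eq_bigr (fun j => (f j i / G j) `^ a j)); last first.
    move=> j _; rewrite powRM ?invr_ge0 ?(ltW (Gp j)) //.
    by rewrite -(powR_inv1 (ltW (Gp j))) -powRrM mulN1r powRN.
  apply: prod_powR_le_sum => // j; apply: divr_ge0 => //; exact: ltW.
rewrite exchange_big /= -a1; apply: ler_sum => j _.
rewrite -mulr_sumr -mulr_suml -/(F j) /G.
case: eqP => [->|aj]; first by rewrite mul0r.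
rewrite divff ?mulr1 //.
by have := h j; rewrite negb_and negbK; case/orP => // /eqP.
Qed.

(** * Blei's inequality for mixed norms *)

Definition mixed_norm (R : rcfType) (T : finType) s (b : s.-tuple T -> R)
  (l : 'I_s) : R := \sum_x Num.sqrt (\sum_(t | tnth t l == x) b t ^+ 2).

Lemma mixed_norm_ge0 (R : rcfType) (T : finType) s (b : s.-tuple T -> R) l :
  0 <= mixed_norm b l.
Proof. by apply: sumr_ge0 => x _; exact: sqrtr_ge0. Qed.

Lemma sum_cond_tuple_cons (V : nmodType) (T : finType) n (P : pred _)
    (F : n.+1.-tuple T -> V) :
  \sum_(t | P t) F t =
  \sum_x \sum_(t : n.-tuple T | P [tuple of x :: t]) F [tuple of x :: t].
Proof.
rewrite big_mkcond sum_tuple_cons; apply: eq_bigr => x _.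
by rewrite [RHS]big_mkcond.
Qed.

Lemma mixed_norm_ord0 (R : rcfType) (T : finType) s (b : s.+1.-tuple T -> R) :
  mixed_norm b ord0 =
  \sum_x Num.sqrt (\sum_(t : s.-tuple T) b [tuple of x :: t] ^+ 2).
Proof.
apply: eq_bigr => x _; congr Num.sqrt.
rewrite sum_cond_tuple_cons (bigD1 x) //= [X in _ + X]big1 ?addr0.
  by apply: eq_bigl => t; rewrite tnth0 eqxx.
by move=> y yx; apply: big_pred0 => t; rewrite tnth0; apply/negbTE.
Qed.

(** Minkowski: moving the l^2 sum over the first coordinate inside the l^1 sum over another
    coordinate can only increase the norm. *)
Lemma mixed_norm_lift (R : rcfType) (T : finType) s (b : s.+1.-tuple T -> R)
    (l : 'I_s) :
  Num.sqrt (\sum_x mixed_norm (fun t => b [tuple of x :: t]) l ^+ 2) <=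
  mixed_norm b (lift ord0 l).
Proof.
apply: (le_trans (minkowski_sum _)); apply: ler_sum => y _.
rewrite le_eqVlt; apply/orP; left; apply/eqP; congr Num.sqrt.
rewrite sum_cond_tuple_cons; apply: eq_bigr => x _.
rewrite sqr_sqrtr; last by apply: sumr_ge0 => t _; exact: sqr_ge0.
by apply: eq_bigl => t; rewrite tnthS.
Qed.

Lemma powR_sqr (R : realType) (x a : R) : 0 <= x -> (x ^+ 2) `^ a = x `^ (2 * a).
Proof. by move=> x0; rewrite -powR_mulrn // -powRrM. Qed.

(* The exponents [1 - s / m] and [1 / m] make the Hoelder weights of the
   inductive step sum to [q * (m + 1) / (2 * m) = 1]. *)
Lemma blei_partial (R : realType) (T : finType) (m s : nat) (q : R)
    (b : s.-tuple T -> R) :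
  (s <= m)%N -> (0 < m)%N -> q = (2 * m)%:R / (m + 1)%:R ->
  (forall t, 0 <= b t) ->
  \sum_t b t `^ q <=
  Num.sqrt (\sum_t b t ^+ 2) `^ (q * (1 - s%:R / m%:R)) *
  \prod_l mixed_norm b l `^ (q / m%:R).
Proof.
move=> sm m0 qE; elim: s sm b => [|s IHs] sm b b0.
  rewrite !sum_tuple0 big_ord0 mul0r subr0 !mulr1 sqrtr_sqr ger0_norm //.
pose N x := Num.sqrt (\sum_(t : s.-tuple T) b [tuple of x :: t] ^+ 2).
have N0 x : 0 <= N x by exact: sqrtr_ge0.
pose A l x := mixed_norm (fun t : s.-tuple T => b [tuple of x :: t]) l.
have A0 l x : 0 <= A l x by exact: mixed_norm_ge0.
have mR : 0 < m%:R :> R by rewrite ltr0n.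
have m1R : 0 < m%:R + 1 :> R by rewrite addr_gt0.
have sR : s.+1%:R <= m%:R :> R by rewrite ler_nat.
have q0 : 0 <= q by rewrite qE divr_ge0.
(* Hölder over the first coordinate [x]. The power of [N x] left by induction is split between
   [N x], which sums to the mixed norm at [ord0], and [N x ^+ 2], which sums to the full l^2 norm
   squared. *)
pose J := (bool + 'I_s)%type.
pose a (j : J) : R := match j with
  | inl true => q / m%:R
  | inl false => q * (1 - s.+1%:R / m%:R) / 2
  | inr _ => q / m%:R / 2
  end.
pose f (j : J) x := match j with
  | inl true => N x
  | inl false => N x ^+ 2
  | inr l => A l x ^+ 2
  end.
have a0 j : 0 <= a j.
  have ? : 0 <= q / m%:R by rewrite divr_ge0 // ltW.
  case: j => [[]|l] //=; last by rewrite divr_ge0.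
  by rewrite divr_ge0 // mulr_ge0 // subr_ge0 ler_pdivrMr // mul1r.
have a1 : \sum_j a j = 1.
  rewrite big_sumType big_bool /= sumr_const card_ord qE natrM natrD.
  rewrite -mulr_natr -(natr1 s); field.
  by rewrite !gt_eqF.
have f0 j x : 0 <= f j x by case: j => [[]|l] //=; exact: sqr_ge0.
rewrite sum_tuple_cons.
apply: (@le_trans _ _ (\sum_x \prod_j f j x `^ a j)).
  apply: ler_sum => x _.
  apply: (le_trans (IHs (ltnW sm) _ (fun t => b0 _))).
  rewrite -/(N x) big_sumType big_bool /= powR_sqr //.
  rewrite -powRD; last first.
    apply/implyP => e; suff : 0 < q / m%:R + 2 * (q * (1 - s.+1%:R / m%:R) / 2).
      by rewrite (eqP e) ltxx.
    rewrite ltr_pwDl //.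
      by rewrite divr_gt0 // qE divr_gt0 // ltr0n ?muln_gt0 ?addn1.
    by have := a0 (inl false); rewrite /a /= => ?; rewrite mulr_ge0.
  rewrite (_ : q / m%:R + _ = q * (1 - s%:R / m%:R)); last first.
    by rewrite -(natr1 s); field; rewrite gt_eqF.
  rewrite le_eqVlt; apply/orP; left; apply/eqP; congr (_ * _).
  apply: eq_bigr => l _; rewrite powR_sqr // -/(A l x); congr (_ `^ _).
  by field; rewrite gt_eqF.
apply: (le_trans (hoelder_sum a0 a1 f0)).
rewrite big_sumType big_bool /= big_ord_recl mixed_norm_ord0 -/N.
rewrite (_ : \sum_x N x ^+ 2 = \sum_t b t ^+ 2); last first.
  rewrite sum_tuple_cons; apply: eq_bigr => x _; rewrite sqr_sqrtr //.
  by apply: sumr_ge0 => t _; exact: sqr_ge0.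
set S := \sum_t b t ^+ 2.
have S0 : 0 <= S by apply: sumr_ge0 => t _; exact: sqr_ge0.
rewrite -[in leLHS](sqr_sqrtr S0) powR_sqr ?sqrtr_ge0 //.
rewrite (_ : 2 * (_ / 2) = q * (1 - s.+1%:R / m%:R)); last by field; rewrite gt_eqF.
rewrite -[leLHS]mulrA [leLHS]mulrCA ler_wpM2l ?powR_ge0 // ler_wpM2l ?powR_ge0 //.
apply: ler_prod => l _; rewrite powR_ge0 /=.
have SA : 0 <= \sum_x A l x ^+ 2 by apply: sumr_ge0 => x _; exact: sqr_ge0.
rewrite -[in leLHS](sqr_sqrtr SA) powR_sqr ?sqrtr_ge0 // mulrCA mulfV // mulr1.
apply: ge0_ler_powR; rewrite ?nnegrE ?sqrtr_ge0 ?mixed_norm_ge0 ?divr_ge0 //.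
exact: mixed_norm_lift.
Qed.

(** * Moduli, roots of unity and Parseval's identity *)

Lemma normc_ge0 (R : rcfType) (x : R[i]) : 0 <= normc x.
Proof. by case: x => a b; exact: sqrtr_ge0. Qed.

Lemma normcD (R : rcfType) (x y : R[i]) : normc (x + y) <= normc x + normc y.
Proof. exact: le_normcD. Qed.

Lemma normc_sub (R : rcfType) (x : R[i]) : normc (- x) = normc x.
Proof. exact: normcN. Qed.

Lemma normc_sum (R : rcfType) (I : Type) (s : seq I) (F : I -> R[i]) :
  normc (\sum_(i <- s) F i) <= \sum_(i <- s) normc (F i).
Proof.
elim: s => [|i s IHs]; first by rewrite !big_nil normc0.
by rewrite !big_cons; apply: (le_trans (normcD _ _)); rewrite lerD2l.
Qed.

Lemma normcX (R : rcfType) (x : R[i]) n : normc (x ^+ n) = normc x ^+ n.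
Proof. by elim: n => [|n IHn]; rewrite ?normc1 // !exprS normcM IHn. Qed.

Lemma normc_prod (R : rcfType) (I : Type) (s : seq I) (F : I -> R[i]) :
  normc (\prod_(i <- s) F i) = \prod_(i <- s) normc (F i).
Proof.
elim: s => [|i s IHs]; first by rewrite !big_nil normc1.
by rewrite !big_cons normcM IHs.
Qed.

Lemma normc_real (R : rcfType) (a : R) : normc a%:C = `|a|.
Proof. by rewrite /= expr0n /= addr0 sqrtr_sqr. Qed.

Lemma normc_nat (R : rcfType) n : normc (n%:R : R[i]) = n%:R :> R.
Proof. by rewrite -(rmorph_nat (real_complex R)) normc_real ger0_norm. Qed.

Lemma normc_sqr (R : rcfType) (x : R[i]) : (normc x ^+ 2)%:C = x * x^*%C.
Proof. by rewrite -sqr_normc rmorphXn. Qed.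

Lemma normc_sqrE (R : rcfType) (a b : R) : normc (a +i* b) ^+ 2 = a ^+ 2 + b ^+ 2.
Proof. by rewrite sqr_sqrtr // addr_ge0 ?sqr_ge0. Qed.

Lemma normc_conj (R : rcfType) (x : R[i]) : normc x^*%C = normc x.
Proof. by case: x => a b /=; rewrite sqrrN. Qed.

(** ['X^n - 1] splits and is separable, so it has [n] distinct roots, and among [n] distinct [n]-th
    roots of unity one is primitive. *)
Lemma closed_prim_root_exists (F : closedFieldType) n :
  (0 < n)%N -> n%:R != 0 :> F -> exists z : F, n.-primitive_root z.
Proof.
move=> n0 nF; have [rs Ers] := closed_field_poly_normal ('X^n - 1 : {poly F}).
have {}Ers : 'X^n - 1 = \prod_(z <- rs) ('X - z%:P).
  by rewrite Ers (monicP (monicXnsubC 1 n0)) scale1r.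
have rsz : size rs = n.
  by apply: succn_inj; rewrite -(size_prod_XsubC rs id) -Ers size_XnsubC.
have : has n.-primitive_root rs.
  apply: has_prim_root; rewrite ?rsz //.
    by apply/allP => z; rewrite -root_prod_XsubC -Ers.
  by rewrite -separable_prod_XsubC -Ers separable_Xn_sub_1.
by case/hasP => z _ zP; exists z.
Qed.

Lemma normc_prim_root (R : rcfType) n (w : R[i]) :
  n.-primitive_root w -> normc w = 1.
Proof.
move=> wP; apply/eqP.
rewrite -(@pexpr_eq1 _ _ n) ?(prim_order_gt0 wP) ?normc_ge0 //.
by rewrite -normcX (prim_expr_order wP) normc1.
Qed.

Lemma sum_prim_root (F : idomainType) n (w : F) k :
  n.-primitive_root w -> ~~ (n %| k)%N -> \sum_(j < n) (w ^+ j) ^+ k = 0.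
Proof.
move=> wP nk.
have : (w ^+ k) ^+ n - 1 = 0 by rewrite exprAC (prim_expr_order wP) expr1n subrr.
rewrite subrX1 => /eqP; rewrite mulf_eq0 subr_eq0 -(prim_order_dvd wP).
rewrite (negbTE nk) => /eqP {2}<-.
by apply: eq_bigr => j _; rewrite exprAC.
Qed.

Lemma sum_prim_root_conj (R : rcfType) n (w : R[i]) (k l : 'I_n) :
  n.-primitive_root w ->
  \sum_(j < n) (w ^+ j) ^+ k * ((w ^+ j) ^+ l)^*%C = (k == l)%:R * n%:R.
Proof.
move=> wP.
have wc i : (w ^+ i) * (w ^+ i)^*%C = 1.
  by rewrite -normc_sqr normcX (normc_prim_root wP) !expr1n.
have [<-|kl] := eqVneq k l.
  rewrite mul1r (eq_bigr (fun=> 1)) ?sumr_const ?card_ord // => j _.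
  by rewrite -exprM wc.
(* On roots of unity, conjugating the power [l] gives the power [n - l]. Since [s] lies strictly
   between 0 and [2 * n], it is divisible by [n] only if [k = l]. *)
rewrite mul0r; set s := (k + (n - l))%N.
rewrite -[RHS](@sum_prim_root _ n w s wP).
  apply: eq_bigr => j _; rewrite /s exprD -!exprM; congr (_ * _).
  have := wc (j * l)%N; set c := conjc _ => cE.
  have wl0 : w ^+ (j * l) != 0.
    by apply/negP => /eqP w0; move/eqP: cE; rewrite w0 mul0r eq_sym oner_eq0.
  apply: (mulfI wl0); rewrite cE -exprD -mulnDr.
  by rewrite subnKC ?(ltnW (ltn_ord l)) // mulnC exprM (prim_expr_order wP) expr1n.
apply/negP => /dvdnP[d dE]; move: kl => /eqP; apply; apply: val_inj => /=.
have := ltn_ord k; have := ltn_ord l; rewrite /s in dE.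
case: d dE => [|[|d]] dE; [lia | lia |].
nia.
Qed.

Lemma parseval (R : rcfType) n (w : R[i]) (p : {poly R[i]}) :
  n.-primitive_root w -> (size p <= n)%N ->
  \sum_(j < n) normc p.[w ^+ j] ^+ 2 = n%:R * \sum_(k < n) normc p`_k ^+ 2.
Proof.
move=> wP sp; apply: (@complexI R); rewrite !rmorphM !rmorph_sum /=.
under eq_bigr => j _ do
  rewrite normc_sqr (horner_coef_wide _ sp) rmorph_sum big_distrlr /=.
rewrite exchange_big /= rmorph_nat mulr_sumr; apply: eq_bigr => k _.
have E (l : 'I_n) : \sum_(j < n) (p`_k * (w ^+ j) ^+ k) * (p`_l * (w ^+ j) ^+ l)^*%C
    = p`_k * (p`_l)^*%C * ((k == l)%:R * n%:R).
  rewrite -(@sum_prim_root_conj _ _ w k l wP) mulr_sumr; apply: eq_bigr => j _.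
  by rewrite rmorphM mulrACA.
rewrite exchange_big /= (bigD1 k) //= [X in _ + X]big1 ?addr0 => [|l lk].
  by rewrite E eqxx mul1r normc_sqr mulrC.
by rewrite E eq_sym (negbTE lk) mul0r mulr0.
Qed.

Lemma parseval_radius (R : rcfType) n (w : R[i]) (r : R) (p : {poly R[i]}) :
  n.-primitive_root w -> (size p <= n)%N ->
  \sum_(j < n) normc p.[r%:C * w ^+ j] ^+ 2 =
  n%:R * \sum_(k < n) normc p`_k ^+ 2 * (r ^+ 2) ^+ k.
Proof.
move=> wP sp; pose q := \poly_(k < n) (r%:C ^+ k * p`_k).
have := parseval wP (size_poly _ _ : (size q <= n)%N).
rewrite (eq_bigr (fun j : 'I_n => normc p.[r%:C * w ^+ j] ^+ 2)) => [->|j _].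
  congr (_ * _); apply: eq_bigr => k _; rewrite coef_poly ltn_ord normcM.
  by rewrite normcX normc_real exprMn mulrC [in LHS]exprAC real_normK ?num_real.
rewrite horner_poly (horner_coef_wide _ sp); congr (normc _ ^+ 2).
by apply: eq_bigr => k _; rewrite exprMn [RHS]mulrCA mulrA.
Qed.

(** The discrete mean value property: every other power averages to zero as long as the degree stays
    below [n]. *)
Lemma sum_horner_prim_root (F : idomainType) n (w : F) (p : {poly F}) :
  n.-primitive_root w -> (size p <= n)%N ->
  \sum_(j < n) p.[w ^+ j] = n%:R * p`_0.
Proof.
move=> wP sp; have n0 := prim_order_gt0 wP.
under eq_bigr => j _ do rewrite (horner_coef_wide _ sp).
rewrite exchange_big /= (bigD1 (Ordinal n0)) //= [X in _ + X]big1 ?addr0 => [|k k0].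
  under eq_bigr => j _ do rewrite /= expr0 mulr1.
  by rewrite sumr_const card_ord mulr_natl.
rewrite -mulr_sumr sum_prim_root ?mulr0 //.
rewrite gtnNdvd // lt0n; apply: contra k0 => /eqP k0.
by apply/eqP/val_inj.
Qed.

Lemma sqr_sum_le (R : rcfType) n (f : 'I_n -> R) :
  (\sum_i f i) ^+ 2 <= n%:R * \sum_i f i ^+ 2.
Proof.
have S0 : 0 <= \sum_i f i ^+ 2 by apply: sumr_ge0 => i _; exact: sqr_ge0.
have := sum_mul_le_sqrt (fun=> 1) (fun i => `|f i|).
under eq_bigr do rewrite mul1r.
under [X in _ <= _ * Num.sqrt X]eq_bigr do rewrite real_normK ?num_real //.
rewrite expr1n sumr_const card_ord => h.
have {h} : `|\sum_i f i| <= Num.sqrt n%:R * Num.sqrt (\sum_i f i ^+ 2).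
  exact: le_trans (ler_norm_sum _ _ _) h.
rewrite -sqrtrM // -ler_sqr ?nnegrE ?sqrtr_ge0 //.
by rewrite real_normK ?num_real // sqr_sqrtr // mulr_ge0.
Qed.

(* The weights [2 ^ -k] absorb the number [k + 1] of products in the [k]-th
   coefficient. *)
Lemma weighted_coef_mul_le (R : rcfType) D n (p q : {poly R[i]}) :
  (size p <= n)%N -> (size q <= n)%N ->
  \sum_(k < D) normc (p * q)`_k ^+ 2 * 2^-1 ^+ k <=
  (\sum_(k < n) normc p`_k ^+ 2) * (\sum_(k < n) normc q`_k ^+ 2).
Proof.
(* With the squared moduli as coefficients of [sqn], the right-hand side is the value at 1 of a
   product of two polynomials. *)
move=> sp sq; pose sqn (p : {poly R[i]}) := \poly_(k < n) normc p`_k ^+ 2.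
have sqnE (s : {poly R[i]}) k : (size s <= n)%N -> (sqn s)`_k = normc s`_k ^+ 2.
  move=> ss; rewrite coef_poly; case: ltnP => // nk.
  by rewrite nth_default ?normc0 ?expr0n // (leq_trans ss).
have sqn1 s : (sqn s).[1] = \sum_(k < n) normc s`_k ^+ 2.
  by rewrite horner_poly; apply: eq_bigr => k _; rewrite expr1n mulr1.
have c0 k : 0 <= (sqn p * sqn q)`_k.
  rewrite coefM; apply: sumr_ge0 => j _.
  by rewrite !sqnE // mulr_ge0 ?sqr_ge0.
rewrite -!sqn1 -hornerM.
rewrite (@horner_coef_wide _ (D + size (sqn p * sqn q))) ?leq_addl //.
rewrite big_split_ord /= -[leLHS]addr0; apply: lerD; last first.
  by apply: sumr_ge0 => k _; rewrite expr1n mulr1.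
apply: ler_sum => k _; rewrite expr1n mulr1 exprVn ler_pdivrMr ?exprn_gt0 //.
have k2 : k.+1%:R <= 2 ^+ k :> R by rewrite -natrX ler_nat ltn_expl.
apply: (@le_trans _ _ (k.+1%:R * (sqn p * sqn q)`_k)); last first.
  by rewrite mulrC ler_wpM2l.
rewrite !coefM.
apply: (@le_trans _ _ ((\sum_(j < k.+1) normc p`_j * normc q`_(k - j)) ^+ 2)).
  rewrite ler_sqr ?nnegrE ?normc_ge0 ?sumr_ge0 // => [|j _].
    apply: (le_trans (normc_sum _ _)).
    by rewrite le_eqVlt; apply/orP; left; apply/eqP/eq_bigr => j _; exact: normcM.
  by rewrite mulr_ge0 ?normc_ge0.
apply: (le_trans (sqr_sum_le _)); rewrite ler_wpM2l // ler_sum // => j _.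
by rewrite !sqnE // exprMn.
Qed.

(* [1 - sqrt_iter w n] tends to a square root of [1 - w x]; [sqrt_iter1] is the
   same iteration at [w x = 1], which dominates it on the closed disc. *)
Fixpoint sqrt_iter (R : rcfType) (w : R[i]) n : {poly R[i]} :=
  if n is n'.+1 then 2^-1 *: (w *: 'X + sqrt_iter w n' ^+ 2) else 0.

Fixpoint sqrt_iter1 (R : rcfType) n : R :=
  if n is n'.+1 then (1 + sqrt_iter1 R n' ^+ 2) / 2 else 0.

Lemma size_sqrt_iter (R : rcfType) (w : R[i]) n :
  (size (sqrt_iter w n) <= 2 ^ n + 1)%N.
Proof.
elim: n => [|n IHn]; first by rewrite size_poly0.
apply: (leq_trans (size_scale_leq _ _)).
apply: (leq_trans (size_polyD _ _)); rewrite geq_max; apply/andP; split.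
  by apply: (leq_trans (size_scale_leq _ _)); rewrite size_polyX addn1 ltnS expn_gt0.
rewrite expr2; apply: (leq_trans (size_polyMleq _ _)).
by rewrite expnS; move: IHn; set s := size _; lia.
Qed.

(** One iteration turns the defect [d = 1 - sqrt_iter1 R n] into [d - d ^+ 2 / 2], which forces
    decay of order 1 / n. *)
Lemma sqrt_iter1_bound (R : rcfType) n :
  0 <= sqrt_iter1 R n <= 1 /\ 1 - sqrt_iter1 R n <= 2 / (n.+1)%:R.
Proof.
elim: n => [|n [/andP[v0 v1] IHn]] /=; first by rewrite lexx ler01 subr0 divr1 ler1n.
set v := sqrt_iter1 R n in v0 v1 IHn *.
split; first by apply/andP; split; nra.
have n0 : 0 < n.+1%:R :> R by rewrite ltr0n.
move: IHn; rewrite !ler_pdivlMr ?ltr0n // -(natr1 n.+1) => IHn.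
nra.
Qed.

(** Majorant argument: in both iterations the next difference is half of (difference) * (sum) of the
    two last iterates, so the scalar bounds propagate. *)
Lemma sqrt_iter_bound (R : rcfType) (w x : R[i]) n :
  normc w <= 1 -> normc x <= 1 ->
  normc (sqrt_iter w n).[x] <= sqrt_iter1 R n /\
  normc ((sqrt_iter w n.+1).[x] - (sqrt_iter w n).[x]) <=
    sqrt_iter1 R n.+1 - sqrt_iter1 R n.
Proof.
move=> w1 x1.
have h2 : normc (2^-1 : R[i]) = 2^-1 :> R.
  by rewrite normcV normc_nat.
have wx : normc (w * x) <= 1.
  by rewrite normcM mulr_ile1 ?normc_ge0.
elim: n => [|n [IH1 IH2]].
  rewrite /= !hornerE normc0 lexx expr0n /= !addr0 !subr0 normcM h2.
  by split => //; lra.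
have vn := (sqrt_iter1_bound R n).1; have vn1 := (sqrt_iter1_bound R n.+1).1.
have H1 : normc (sqrt_iter w n.+1).[x] <= sqrt_iter1 R n.+1.
  rewrite /= !hornerE normcM h2 mulrC ler_wpM2r //.
  apply: (le_trans (normcD _ _)); rewrite lerD // normcX.
  by rewrite ler_sqr ?nnegrE ?normc_ge0 //; case/andP: vn.
split => //.
rewrite [sqrt_iter w n.+2]/= [sqrt_iter1 R n.+2]/=.
set a := sqrt_iter w n.+1 in H1 IH2 *; set b := sqrt_iter w n in IH1 IH2 *.
have aE : a.[x] = 2^-1 * (w * x + b.[x] ^+ 2) by rewrite /a /= !hornerE.
have -> : (2^-1 *: (w *: 'X + a ^+ 2)).[x] - a.[x] =
    2^-1 * ((a.[x] - b.[x]) * (a.[x] + b.[x])).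
  by clearbody a b; rewrite [X in _ - X]aE hornerZ hornerD hornerZ hornerX horner_exp; ring.
set va := sqrt_iter1 R n.+1 in H1 IH2 vn1 *; set vb := sqrt_iter1 R n in IH1 IH2 vn *.
have -> : (1 + va ^+ 2) / 2 - va = 2^-1 * ((va - vb) * (va + vb)).
  rewrite [X in _ - X](_ : _ = (1 + vb ^+ 2) / 2); last by [].
  by field.
rewrite !normcM h2 ler_wpM2l // ler_pM ?normc_ge0 //.
by apply: (le_trans (normcD _ _)); rewrite lerD.
Qed.

(** * Hypercontractivity *)

Lemma exists_nat_inv_le (R : archiRealFieldType) (d : R) : 0 < d ->
  exists n, 2 / n.+1%:R <= d.
Proof.
move=> d0; exists (Num.trunc (2 / d)).
rewrite ler_pdivrMr ?ltr0n // mulrC -ler_pdivrMr //.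
by apply: ltW; apply: truncnS_gt.
Qed.

(** The error of [1 - u] as a square root is twice the next step of the iteration, hence at most
    [(1 - v) ^+ 2]. The size bound is uniform in [w]. *)
Lemma sqrt_approx (R : realType) (d : R) : 0 < d ->
  exists n : nat, forall w : R[i], normc w <= 1 -> exists s : {poly R[i]},
    (size s <= n)%N /\ forall x, normc x <= 1 ->
    normc s.[x] <= 2 /\ normc (1 - w * x - s.[x] ^+ 2) <= d.
Proof.
move=> d0; have [n nd] := exists_nat_inv_le d0.
exists (2 ^ n + 1)%N => w w1; exists (1 - sqrt_iter w n); split=> [|x x1].
  apply: (leq_trans (size_polyD _ _)); rewrite size_polyN geq_max size_poly1.
  by rewrite size_sqrt_iter addn1.
have [U1 U2] := sqrt_iter_bound n w1 x1.
have [/andP[v0 v1] ve] := sqrt_iter1_bound R n.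
rewrite /= hornerZ hornerD hornerZ hornerX horner_exp in U2.
rewrite hornerD hornerN hornerC; set u := (sqrt_iter w n).[x] in U1 U2 *.
set v := sqrt_iter1 R n in U1 U2 v0 v1 ve *.
split.
  by apply: (le_trans (normcD _ _)); rewrite normc_sub normc1; lra.
have -> : 1 - w * x - (1 - u) ^+ 2 = - (2 * (2^-1 * (w * x + u ^+ 2) - u)).
  by field.
rewrite normc_sub normcM normc_nat.
apply: le_trans (le_trans ve nd); nra.
Qed.

Lemma prod_approx (R : realType) k (e : R) : 0 < e ->
  exists n : nat, forall ws : seq R[i], (size ws <= k)%N ->
    all (fun w => normc w <= 1) ws -> exists h : {poly R[i]},
    (size h <= n)%N /\ forall x, normc x <= 1 ->
    normc (\prod_(w <- ws) (1 - w * x) - h.[x] ^+ 2) <= e.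
Proof.
(* Each factor and each squared approximate root has modulus at most 4, so replacing at most [k]
   factors one by one costs at most [k%:R * 4 ^+ k * d]; [k.+1] keeps the denominator nonzero. *)
move=> e0; pose d := e / (k.+1%:R * 4 ^+ k).
have d0 : 0 < d by rewrite divr_gt0 // mulr_gt0 ?ltr0n // exprn_gt0.
have [n nP] := sqrt_approx d0.
exists (k * n + 1)%N => ws wsk ws1.
suff [h [hs hP]] : exists h : {poly R[i]}, (size h <= size ws * n + 1)%N /\
    forall x, normc x <= 1 -> [/\ normc h.[x] ^+ 2 <= 4 ^+ size ws,
      normc (\prod_(w <- ws) (1 - w * x)) <= 4 ^+ size ws &
      normc (\prod_(w <- ws) (1 - w * x) - h.[x] ^+ 2) <=
        (size ws)%:R * 4 ^+ size ws * d].
  exists h; split.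
    by apply: (leq_trans hs); rewrite leq_add2r leq_mul2r wsk orbT.
  move=> x x1; have [_ _ hx] := hP x x1; apply: (le_trans hx).
  have -> : e = k.+1%:R * 4 ^+ k * d.
    by rewrite mulrC divfK // gt_eqF // mulr_gt0 ?ltr0n // exprn_gt0.
  rewrite ler_wpM2r ?(ltW d0) // ler_pM ?ler0n ?exprn_ge0 // ?ler_nat.
    exact: leq_trans wsk _.
  by rewrite ler_weXn2l // ler1n.
elim: ws ws1 {wsk} => [_|w ws IHws /= /andP[w1 ws1]].
  exists 1; rewrite size_poly1; split => // x _.
  by rewrite big_nil hornerC expr1n subrr normc0 normc1 expr0 mulr1 mul0r expr1n.
have [h [hs hP]] := IHws ws1; have [s [ss sP]] := nP w w1.
exists (s * h); split.
  apply: (leq_trans (size_polyMleq _ _)); move: ss hs.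
  by set a := size s; set b := size h; rewrite mulSn; lia.
move=> x x1; have [h1 h2 h3] := hP x x1; have [s1 s2] := sP x x1.
have wx : normc (w * x) <= 1 by rewrite normcM mulr_ile1 ?normc_ge0.
have s4 : normc s.[x] ^+ 2 <= 4.
  by have := normc_ge0 s.[x]; nra.
have P0 : 0 <= 4 ^+ size ws :> R by rewrite exprn_ge0.
have wx2 : normc (1 - w * x) <= 2.
  by apply: (le_trans (normcD _ _)); rewrite normc_sub normc1; lra.
rewrite big_cons hornerM !normcM !exprMn !(exprS 4); split.
- by rewrite ler_pM ?sqr_ge0.
- by rewrite ler_pM ?normc_ge0 //; lra.
set A := \prod_(w <- ws) _ in h2 h3 *.
have -> : (1 - w * x) * A - s.[x] ^+ 2 * h.[x] ^+ 2 =
    (1 - w * x - s.[x] ^+ 2) * A + s.[x] ^+ 2 * (A - h.[x] ^+ 2) by ring.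
apply: (le_trans (normcD _ _)); rewrite (normcM _ A) (normcM (_ ^+ 2)) normcX.
apply: (@le_trans _ _ (d * 4 ^+ size ws + 4 * ((size ws)%:R * 4 ^+ size ws * d))).
  by rewrite lerD // ler_pM ?normc_ge0 ?sqr_ge0.
rewrite -(natr1 (size ws)); have := mulr_ge0 P0 (ltW d0); nra.
Qed.

(* A root inside the unit disc is reflected to [1 / r^*]: this leaves the
   modulus unchanged on the circle and increases it inside. *)
Lemma reflect_root (R : rcfType) (r : R[i]) : exists k w : R[i],
  normc w <= 1 /\ forall x, normc x <= 1 ->
    normc (x - r) <= normc (k * (1 - w * x)) /\
    (normc x = 1 -> normc (x - r) = normc (k * (1 - w * x))).
Proof.
have [r1|r1] := leP (normc r) 1.
  exists 1, r^*%C; rewrite normc_conj; split => // x x1; rewrite mul1r.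
  have E : normc (1 - r^*%C * x) ^+ 2 =
      normc (x - r) ^+ 2 + (1 - normc r ^+ 2) * (1 - normc x ^+ 2).
    case: x r {x1 r1} => [a b] [c d].
    have -> : 1 - (c +i* d)^*%C * (a +i* b) = (1 - (c * a + d * b)) +i* (d * a - c * b).
      by apply/eqP; rewrite eq_complex /=; apply/andP; split; apply/eqP; ring.
    have -> : (a +i* b) - (c +i* d) = (a - c) +i* (b - d) by [].
    by rewrite !normc_sqrE; ring.
  split=> [|xe]; last first.
    apply/eqP; rewrite -(@eqrXn2 _ 2) ?normc_ge0 //.
    by rewrite E xe expr1n subrr mulr0 addr0.
  rewrite -ler_sqr ?nnegrE ?normc_ge0 // E lerDl mulr_ge0 // subr_ge0.
    by rewrite exprn_ile1 ?normc_ge0.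
  by rewrite exprn_ile1 ?normc_ge0.
have r0 : r != 0 by apply: contraTneq r1 => ->; rewrite normc0 -leNgt ler01.
exists (- r), r^-1; split.
  by rewrite normcV invf_le1 ?(ltW r1) // (lt_trans ltr01 r1).
move=> x _; suff -> : - r * (1 - r^-1 * x) = x - r by split.
by field.
Qed.

Lemma reflect_roots (R : rcfType) (rs : seq R[i]) : exists (c : R[i]) ws,
  [/\ size ws = size rs, all (fun w => normc w <= 1) ws &
  forall x, normc x <= 1 ->
    normc (\prod_(r <- rs) (x - r)) <= normc (c * \prod_(w <- ws) (1 - w * x)) /\
    (normc x = 1 -> normc (\prod_(r <- rs) (x - r)) =
                    normc (c * \prod_(w <- ws) (1 - w * x)))].
Proof.
elim: rs => [|r rs [c [ws [sws ws1 wsP]]]].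
  by exists 1, [::]; split=> // x _; rewrite !big_nil mul1r.
have [k [w [w1 wP]]] := reflect_root r.
exists (k * c), (w :: ws); rewrite /= sws w1 ws1; split => // x x1.
have [a1 a2] := wP x x1; have [b1 b2] := wsP x x1.
rewrite !big_cons mulrACA !(normcM (_ - _)) !(normcM (k * _)).
by split=> [|xe]; [rewrite ler_pM ?normc_ge0 | rewrite a2 // b2].
Qed.

(** The left-hand side is the L^2 norm of [F] on the circle of radius [rho = Num.sqrt 2^-1]. [N] is
    chosen before [F], which tensorization needs. *)
Lemma hypercontractive1 (R : realType) D (e : R) : 0 < e ->
  exists N (w : R[i]), N.-primitive_root w /\ forall F : {poly R[i]},
    (size F <= D)%N ->
    Num.sqrt (\sum_(k < D) normc F`_k ^+ 2 * 2^-1 ^+ k) <=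
    (1 + e) * (N%:R^-1 * \sum_(j < N) normc F.[w ^+ j]).
Proof.
(* The error [e / 2] is spent twice, on the unit circle and on the circle of radius [rho], both
   times multiplied by [a <= S]. *)
move=> e0; have e20 : 0 < e / 2 by rewrite divr_gt0.
(* [N] exceeds the size bounds of [F], [h] and [h * h], so Parseval's identity is exact for all
   three. *)
have [n nP] := prod_approx D e20; pose N := (D + (n + n)).+1.
have DN : (D <= N)%N by rewrite ltnW // ltnS leq_addr.
have nnN : (n + n <= N)%N by rewrite ltnW // ltnS leq_addl.
have [|w wP] := @closed_prim_root_exists R[i] N isT; first by rewrite pnatr_eq0.
exists N, w; split=> // F sF.
have N0 : 0 < N%:R :> R by rewrite ltr0n.
set S := _^-1 * _.
have S0 : 0 <= S.
  by rewrite mulr_ge0 ?invr_ge0 ?ler0n ?sumr_ge0 // => j _; exact: normc_ge0.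
have [F0|Fn0] := eqVneq F 0.
  rewrite big1 => [|k _]; last by rewrite F0 coef0 normc0 expr0n mul0r.
  by rewrite sqrtr0 mulr_ge0 // addr_ge0 ?ler01 ?ltW.
have [rs FE] := closed_field_poly_normal F.
have sFrs : size F = (size rs).+1.
  by rewrite FE size_scale ?lead_coef_eq0 // (size_prod_XsubC _ id).
have [c0 [ws [sws ws1 wsP]]] := reflect_roots rs.
have [|h [sh hP]] := nP ws _ ws1; first by rewrite sws ltnW // -sFrs.
pose A x := \prod_(w <- ws) (1 - w * x); pose c := lead_coef F * c0.
have FA x : normc x <= 1 -> normc F.[x] <= normc (c * A x) /\
    (normc x = 1 -> normc F.[x] = normc (c * A x)).
  move=> x1; have [p1 p2] := wsP x x1.
  have -> : normc F.[x] = normc (lead_coef F) * normc (\prod_(r <- rs) (x - r)).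
    rewrite {1}FE hornerZ normcM horner_prod; congr (_ * normc _).
    by apply: eq_bigr => r _; rewrite hornerXsubC.
  rewrite /c -mulrA normcM; split=> [|xe]; last by rewrite p2.
  by rewrite ler_wpM2l ?normc_ge0.
have w1 j : normc (w ^+ j) = 1 by rewrite normcX (normc_prim_root wP) expr1n.
have FAw j : normc F.[w ^+ j] = normc (c * A (w ^+ j)).
  by apply: (FA _ _).2; rewrite w1.
pose a := normc c; have a0 : 0 <= a := normc_ge0 c.
(* [c] is the value at 0 of [c * A], hence its mean over the roots of unity, and [c * A] has the
   modulus of [F] there. *)
have aS : a <= S.
  pose g v : {poly R[i]} := 1 - v *: 'X; pose G := c *: \prod_(v <- ws) g v.
  have GE x : G.[x] = c * A x.
    rewrite hornerZ horner_prod; congr (_ * _); apply: eq_bigr => v _.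
    by rewrite hornerD hornerN hornerZ hornerX hornerC.
  have sG : (size G <= N)%N.
    apply: (leq_trans (size_scale_leq _ _)).
    suff : (size (\prod_(v <- ws) g v)%R <= (size ws).+1)%N.
      by move=> /leq_trans; apply; rewrite sws -sFrs (leq_trans sF).
    elim: (ws) => [|v vs IHv]; first by rewrite big_nil size_poly1.
    rewrite big_cons; apply: (leq_trans (size_polyMleq _ _)).
    have : (size (g v) <= 2)%N.
      apply: (leq_trans (size_polyD _ _)); rewrite size_polyN geq_max size_poly1.
      by rewrite (leq_trans (size_scale_leq _ _)) ?size_polyX.
    by move=> gs; rewrite -subn1 leq_subLR (leq_trans (leq_add gs IHv)).
  have := sum_horner_prim_root wP sG.
  have A0 : A 0 = 1 by rewrite /A big1 // => v _; rewrite mulr0 subr0.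
  rewrite -horner_coef0 GE A0 mulr1 => sE.
  rewrite /S mulrC ler_pdivlMr // mulrC -(normc_nat R N) /a -normcM -sE.
  apply: (le_trans (normc_sum _ _)); apply: ler_sum => j _.
  by rewrite GE FAw.
pose rho : R := Num.sqrt 2^-1.
have rho2 : rho ^+ 2 = 2^-1 by rewrite sqr_sqrtr.
have t1 j : normc (rho%:C * w ^+ j) <= 1.
  rewrite normcM w1 mulr1 normc_real ger0_norm ?sqrtr_ge0 //.
  by rewrite -ler_sqr ?nnegrE ?sqrtr_ge0 // rho2; lra.
have hs : (size h <= N)%N by rewrite (leq_trans sh) // (leq_trans _ nnN) // leq_addr.
have hhs : (size (h * h)%R <= N)%N.
  apply: (leq_trans (size_polyMleq _ _)); apply: (leq_trans (leq_pred _)).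
  exact: leq_trans (leq_add sh sh) nnN.
pose H := N%:R^-1 * \sum_(j < N) normc h.[w ^+ j] ^+ 2.
have HE : H = \sum_(k < N) normc h`_k ^+ 2.
  by rewrite /H (parseval wP hs) mulKf // gt_eqF.
have H0 : 0 <= H by rewrite HE sumr_ge0 // => k _; exact: sqr_ge0.
have cAh x : normc x <= 1 -> normc (c * (A x - h.[x] ^+ 2)) <= a * (e / 2).
  by move=> x1; rewrite normcM ler_wpM2l // hP.
have aH : a * H <= S + a * (e / 2).
  rewrite -(ler_pM2l N0) mulrDr /H /S mulrCA !mulVKf ?gt_eqF // mulr_sumr.
  rewrite -[N in N%:R]card_ord mulr_natl -sumr_const -big_split /=.
  apply: ler_sum => j _; apply: (le_trans _ (lerD (lexx _) (cAh (w ^+ j) _))).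
    rewrite FAw -normcX -normcM -[normc (c * (_ - _))]normc_sub.
    apply: le_trans (normcD _ _); rewrite le_eqVlt; apply/orP; left; apply/eqP.
    by congr normc; ring.
  by rewrite w1.
(* Inside the disc [F] is only dominated by [c * A], which suffices here; [weighted_coef_mul_le]
   bounds the L^2 norm of [h * h] at radius [rho] by [H]. *)
have WF : Num.sqrt (\sum_(j < N) normc F.[rho%:C * w ^+ j] ^+ 2) <=
    Num.sqrt N%:R * (a * H + a * (e / 2)).
  pose f (j : 'I_N) := a * normc (h * h).[rho%:C * w ^+ j].
  apply: (@le_trans _ _ (Num.sqrt (\sum_(j < N) (f j + a * (e / 2)) ^+ 2))).
    apply: ler_wsqrtr; apply: ler_sum => j _.
    have Fj : normc F.[rho%:C * w ^+ j] <= f j + a * (e / 2).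
      apply: (le_trans (FA _ (t1 j)).1).
      apply: (le_trans _ (lerD (lexx _) (cAh _ (t1 j)))).
      rewrite /f -normcM hornerM; apply: le_trans (normcD _ _).
      rewrite le_eqVlt; apply/orP; left; apply/eqP; congr normc; ring.
    by rewrite ler_sqr ?nnegrE ?normc_ge0 // (le_trans (normc_ge0 _) Fj).
  apply: (le_trans (sqrt_sum_sqrD _ _)); rewrite mulrDr; apply: lerD.
    under eq_bigr => j _ do rewrite /f exprMn.
    rewrite -mulr_sumr (parseval_radius rho wP hhs) rho2 mulrCA sqrtrM ?ler0n //.
    rewrite ler_wpM2l ?sqrtr_ge0 // sqrtrM ?sqr_ge0 // sqrtr_sqr ger0_norm //.
    rewrite ler_wpM2l // -[leRHS]ger0_norm // -sqrtr_sqr ler_wsqrtr //.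
    by rewrite HE expr2; exact: weighted_coef_mul_le.
  rewrite sumr_const card_ord -[_ ^+ 2 *+ N]mulr_natl sqrtrM ?ler0n // sqrtr_sqr ger0_norm //.
  by rewrite mulr_ge0 // ltW.
rewrite (parseval_radius rho wP) ?rho2 in WF; last exact: leq_trans sF DN.
have sN0 : 0 < Num.sqrt N%:R :> R by rewrite sqrtr_gt0.
rewrite sqrtrM ?ler0n // ler_pM2l // in WF.
apply: (@le_trans _ _ (Num.sqrt (\sum_(k < N) normc F`_k ^+ 2 * 2^-1 ^+ k))).
  apply: ler_wsqrtr; rewrite -(subnKC DN) big_split_ord /= lerDl.
  by apply: sumr_ge0 => k _; rewrite mulr_ge0 ?sqr_ge0 // exprn_ge0.
apply: (le_trans WF); have aSe := ler_wpM2r (ltW e20) aS.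
by lra.
Qed.

(** Induction on the number of variables: the induction hypothesis treats all variables but the
    first, Minkowski moves the l^2 sum over the first exponent inside the mean, and the one-variable
    bound finishes. *)
Lemma hypercontractive_tensor (R : rcfType) D N (z : 'I_N -> R[i]) (K : R) :
  0 <= K ->
  (forall a : 'I_D -> R[i],
    Num.sqrt (\sum_k normc (a k) ^+ 2 * 2^-1 ^+ k) <=
    K * (N%:R^-1 * \sum_j normc (\sum_k a k * z j ^+ k))) ->
  forall n (a : n.-tuple 'I_D -> R[i]),
    Num.sqrt (\sum_t normc (a t) ^+ 2 * \prod_i 2^-1 ^+ tnth t i) <=
    (K / N%:R) ^+ n * \sum_(u : n.-tuple 'I_N)
       normc (\sum_t a t * \prod_i z (tnth u i) ^+ tnth t i).
Proof.
move=> K0 H; elim=> [|n IHn] a.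
  by rewrite !sum_tuple0 !big_ord0 !mulr1 mul1r sqrtr_sqr ger0_norm ?normc_ge0.
pose c := (K / N%:R) ^+ n.
have c0 : 0 <= c by rewrite exprn_ge0 // divr_ge0.
pose P k (u : n.-tuple 'I_N) := \sum_(t : n.-tuple 'I_D)
  a [tuple of k :: t] * \prod_i z (tnth u i) ^+ tnth t i.
pose s (k : 'I_D) : R := Num.sqrt (2^-1 ^+ k).
have s2 k : s k ^+ 2 = 2^-1 ^+ k by rewrite sqr_sqrtr // exprn_ge0.
apply: (@le_trans _ _ (Num.sqrt (\sum_k (\sum_u c * s k * normc (P k u)) ^+ 2))).
  apply: ler_wsqrtr; rewrite sum_tuple_cons; apply: ler_sum => k _.
  have {}IHn := IHn (fun t => a [tuple of k :: t]).
  set W := \sum_t _ in IHn *.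
  rewrite (_ : \sum_(t : n.-tuple 'I_D) _ = s k ^+ 2 * W); last first.
    rewrite s2 mulr_sumr; apply: eq_bigr => t _.
    rewrite big_ord_recl tnth0 mulrCA; congr (_ * (_ * _)).
    by apply: eq_bigr => i _; rewrite tnthS.
  have W0 : 0 <= W.
    apply: sumr_ge0 => t _; apply: mulr_ge0; first exact: sqr_ge0.
    by apply: prodr_ge0 => i _; apply: exprn_ge0.
  rewrite -[W]sqr_sqrtr // -exprMn ler_sqr ?nnegrE; last 2 first.
  - by rewrite mulr_ge0 ?sqrtr_ge0.
  - by apply: sumr_ge0 => u _; rewrite !mulr_ge0 ?sqrtr_ge0 ?normc_ge0.
  by rewrite -mulr_sumr [c * _]mulrC -mulrA ler_wpM2l ?sqrtr_ge0.
apply: (le_trans (minkowski_sum _)); rewrite sum_tuple_cons exchange_big /= mulr_sumr.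
apply: ler_sum => u _.
rewrite (_ : \sum_k _ = c ^+ 2 * \sum_k normc (P k u) ^+ 2 * 2^-1 ^+ k); last first.
  by rewrite mulr_sumr; apply: eq_bigr => k _; rewrite -s2 !exprMn; ring.
rewrite sqrtrM ?sqr_ge0 // sqrtr_sqr ger0_norm //.
apply: (le_trans (ler_wpM2l c0 (H _))).
rewrite exprSr -/c -!mulrA ler_wpM2l // le_eqVlt; apply/orP; left; apply/eqP.
congr (_ * (_ * _)); apply: eq_bigr => j _; congr normc.
rewrite sum_tuple_cons; apply: eq_bigr => k _.
rewrite mulr_suml; apply: eq_bigr => t _; rewrite big_ord_recl !tnth0.
rewrite mulrAC -mulrA; congr (_ * (_ * _)).
by apply: eq_bigr => i _; rewrite !tnthS.
Qed.

(** * Polarization *)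

(** Cauchy's estimate from Parseval: one term of the coefficient sum is at most the mean square of
    [p] on the circle. *)
Lemma cauchy_coef (R : rcfType) (p : {poly R[i]}) (r B : R) k :
  0 <= r -> (forall x, normc x = r -> normc p.[x] <= B) ->
  normc p`_k * r ^+ k <= B.
Proof.
move=> r0 pB; pose N := (size p + k).+1.
have [|w wP] := @closed_prim_root_exists R[i] N isT; first by rewrite pnatr_eq0.
have N0 : 0 < N%:R :> R by rewrite ltr0n.
have kN : (k < N)%N by rewrite ltnS leq_addl.
have pBj j : normc p.[r%:C * w ^+ j] <= B.
  apply: pB; rewrite normcM normcX (normc_prim_root wP) expr1n mulr1 normc_real.
  exact: ger0_norm.
have B0 : 0 <= B by exact: le_trans (normc_ge0 _) (pBj 0%N).
rewrite -ler_sqr ?nnegrE ?mulr_ge0 ?normc_ge0 ?exprn_ge0 // -(ler_pM2l N0).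
have sp : (size p <= N)%N by rewrite ltnW // ltnS leq_addr.
apply: (@le_trans _ _ (\sum_(j < N) normc p.[r%:C * w ^+ j] ^+ 2)).
  rewrite (parseval_radius r wP sp) ler_wpM2l ?ler0n //.
  rewrite (bigD1 (Ordinal kN)) //= exprMn exprAC lerDl.
  by apply: sumr_ge0 => j _; rewrite mulr_ge0 ?exprn_ge0 ?normc_ge0.
apply: (@le_trans _ _ (\sum_(j < N) B ^+ 2)).
  by apply: ler_sum => j _; rewrite ler_sqr ?nnegrE ?normc_ge0.
by rewrite sumr_const card_ord -[B ^+ 2 *+ N]mulr_natl.
Qed.

Lemma coef1_affine_mul (F : comNzRingType) (a b : F) (q : {poly F}) :
  ((a%:P + b *: 'X) * q)`_1 = b * q`_0 + a * q`_1.
Proof.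
rewrite coefM !big_ord_recl big_ord0 addr0 /= !coefD !coefC !coefZ !coefX /=.
by rewrite mulr0 mulr1 addr0 add0r addrC.
Qed.

Lemma coef0_affine_prod (F : comNzRingType) (T : Type) (z w : T -> F) (s : seq T) :
  (\prod_(x <- s) ((z x)%:P + w x *: 'X))`_0 = \prod_(x <- s) z x.
Proof.
rewrite -horner_coef0 horner_prod; apply: eq_bigr => x _.
by rewrite hornerD hornerC hornerZ hornerX mulr0 addr0.
Qed.

Definition sym_tuple (T : finType) (V : Type) m (c : m.-tuple T -> V) :=
  forall t t' : m.-tuple T, perm_eq t t' -> c t = c t'.

Lemma sym_tuple_cons (T : finType) (V : Type) m (c : m.+1.-tuple T -> V) k :
  sym_tuple c -> sym_tuple (fun t => c [tuple of k :: t]).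
Proof. by move=> cs t t' tt'; apply: cs; rewrite /= perm_cons. Qed.

(** For the symmetric form L with coefficients [c], the part of L(z + X w, ..., z + X w) linear in X
    has one term for each slot taking [w], and by symmetry all these terms agree. *)
Lemma coef1_affine_form (F : comNzRingType) (T : finType) s
    (c : s.+1.-tuple T -> F) (z w : T -> F) :
  sym_tuple c ->
  \sum_t c t * (\prod_(x <- t) ((z x)%:P + w x *: 'X))`_1 =
  s.+1%:R * \sum_k w k * \sum_(u : s.-tuple T)
     c [tuple of k :: u] * \prod_(x <- u) z x.
Proof.
elim: s c => [|s IHs] c cs.
  rewrite sum_tuple_cons mul1r; apply: eq_bigr => k _.
  rewrite !sum_tuple0 /= big_cons coef1_affine_mul !big_nil !coef1 /=.
  by rewrite mulr0 addr0 !mulr1 mulrC.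
rewrite sum_tuple_cons.
under eq_bigr => k _.
  under eq_bigr => t _ do
    rewrite /= big_cons coef1_affine_mul coef0_affine_prod mulrDr mulrCA
            [X in _ + X]mulrCA.
  rewrite big_split /= -!mulr_sumr (IHs _ (sym_tuple_cons k cs)).
  over.
rewrite big_split /= -(natr1 s.+1) mulrDl mul1r addrC; congr (_ + _).
under eq_bigr => k _ do rewrite mulrCA mulr_sumr.
rewrite -mulr_sumr exchange_big /=; congr (_ * _); apply: eq_bigr => l _.
rewrite sum_tuple_cons mulr_sumr; apply: eq_bigr => k _.
rewrite mulrCA; congr (_ * _); rewrite mulr_sumr; apply: eq_bigr => u _.
rewrite /= big_cons mulrCA; congr (_ * (_ * _)).
by apply: cs => /=; rewrite (perm_catCA [:: k] [:: l] u).
Qed.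

Lemma polarization_bound (R : rcfType) (T : finType) M
    (c : M.+1.-tuple T -> R[i]) (S : R) :
  (0 < M)%N -> sym_tuple c ->
  (forall (r : R) (z : T -> R[i]), 0 < r -> (forall x, normc (z x) <= r) ->
     normc (\sum_t c t * \prod_(x <- t) z x) <= r ^+ M.+1 * S) ->
  forall z, (forall x, normc (z x) <= 1) ->
  \sum_k normc (\sum_(u : M.-tuple T) c [tuple of k :: u] * \prod_(x <- u) z x)
    <= (1 + 1 / M%:R) ^+ M * S.
Proof.
move=> M0 cs cS z z1; have MR : 0 < M%:R :> R by rewrite ltr0n.
pose P k := \sum_(u : M.-tuple T) c [tuple of k :: u] * \prod_(x <- u) z x.
(* [w k] is the conjugate phase of [P k], so that [w k * P k] is its modulus; if [P k = 0] then
   [w k = 0], the inverse of 0 being 0. *)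
pose w k := (P k)^*%C * ((normc (P k))^-1)%:C.
have wP k : w k * P k = (normc (P k))%:C.
  rewrite /w mulrAC [_^*%C * _]mulrC -normc_sqr -rmorphM /=.
  have [->|n0] := eqVneq (normc (P k)) 0; first by rewrite invr0 mulr0.
  by rewrite expr2 mulfK.
have w1 k : normc (w k) <= 1.
  rewrite normcM normc_conj normc_real ger0_norm ?invr_ge0 ?normc_ge0 //.
  have [->|n0] := eqVneq (normc (P k)) 0; first by rewrite mul0r.
  by rewrite divff.
pose Q := \sum_t c t *: \prod_(x <- t) ((z x)%:P + w x *: 'X).
have QE x : Q.[x] = \sum_t c t * \prod_(y <- t) (z y + w y * x).
  rewrite horner_sum; apply: eq_bigr => t _; rewrite hornerZ horner_prod.
  congr (_ * _); apply: eq_bigr => y _.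
  by rewrite hornerD hornerC hornerZ hornerX.
have Q1 : Q`_1 = (M.+1%:R * \sum_k normc (P k))%:C.
  rewrite coef_sum; under eq_bigr => t _ do rewrite coefZ.
  rewrite (coef1_affine_form _ _ cs) rmorphM rmorph_nat rmorph_sum.
  by congr (_ * _); apply: eq_bigr => k _; rewrite wP.
(* The radius 1/M minimizes (1 + r)^(M+1) / ((M+1) r); dividing by (M+1)/M = 1 + 1/M lowers the
   exponent to [M]. *)
have r0 : 0 <= M%:R^-1 :> R by rewrite invr_ge0 ltW.
have := @cauchy_coef _ Q M%:R^-1 ((1 + M%:R^-1) ^+ M.+1 * S) 1 r0 _.
rewrite Q1 normc_real ger0_norm; last first.
  by rewrite mulr_ge0 // sumr_ge0 // => k _; exact: normc_ge0.
rewrite expr1 => /(_ _)/wrap[x xr|].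
  rewrite QE; apply: cS => [|y]; first by rewrite ltr_pwDl.
  apply: (le_trans (normcD _ _)); rewrite lerD // normcM xr.
  by rewrite ler_piMl.
have -> : M.+1%:R * (\sum_k normc (P k)) / M%:R = (1 + M%:R^-1) * \sum_k normc (P k).
  by rewrite -(natr1 M); field; rewrite gt_eqF.
by rewrite exprS -mulrA ler_pM2l ?ltr_pwDl // div1r.
Qed.

(** * Rearrangement classes *)

Definition perm_class (T : finType) s (t : s.-tuple T) : nat :=
  #|[pred t' : s.-tuple T | perm_eq t t']|.

Lemma perm_class_gt0 (T : finType) s (t : s.-tuple T) : (0 < perm_class t)%N.
Proof. by apply/card_gt0P; exists t; rewrite inE. Qed.

Lemma perm_class_sym (T : finType) s : sym_tuple (@perm_class T s).
Proof.
move=> t t' tt'; apply: eq_card => t''; rewrite !inE.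
exact: (permPl tt').
Qed.

(* A rearrangement of [k :: u] is determined by the position of its first [k]
   and by the rearrangement of [u] left after removing it. *)
Lemma perm_class_cons (T : finType) s (k : T) (u : s.-tuple T) :
  (perm_class [tuple of k :: u] <= s.+1 * perm_class u)%N.
Proof.
pose ins (p : 'I_s.+1 * s.-tuple T) : s.+1.-tuple T :=
  insubd [tuple of k :: u] (take p.1 p.2 ++ k :: drop p.1 p.2).
pose A : {set _} := finset.setX [set: 'I_s.+1] [set u' : s.-tuple T | perm_eq u u'].
have cA : #|A| = (s.+1 * perm_class u)%N.
  by rewrite cardsX cardsT card_ord cardsE.
rewrite -cA; apply: leq_trans (leq_imset_card ins A).
apply: subset_leq_card; apply/fintype.subsetP => t; rewrite inE /= => kut.
have kt : k \in tval t by rewrite -(perm_mem kut) mem_head.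
have it : (index k t < s.+1)%N by rewrite -{2}(size_tuple t) index_mem.
have st : size (rem k t) == s by rewrite size_rem // size_tuple.
apply/imsetP; exists (Ordinal it, Tuple st).
  rewrite finset.in_setX finset.in_setT finset.inE /= -(perm_cons k) (perm_trans kut) //.
  exact: perm_to_rem.
apply: val_inj; rewrite val_insubd /=.
suff -> : take (index k t) (rem k t) ++ k :: drop (index k t) (rem k t) = t.
  by rewrite size_tuple eqxx.
have ti : size (take (index k t) t) = index k t by rewrite size_takel // ltnW // index_mem.
rewrite remE take_size_cat // drop_size_cat //.
by rewrite -{2}(nth_index k kt) -drop_nth ?index_mem // cat_take_drop.
Qed.

Lemma prod_count (F : comNzRingType) (T : finType) (z : T -> F) (s : seq T) :
  \prod_x z x ^+ count_mem x s = \prod_(x <- s) z x.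
Proof.
elim: s => [|y s IHs]; first by rewrite big_nil big1.
rewrite big_cons -IHs /=; under eq_bigr => x _ do rewrite exprD.
rewrite big_split /=; congr (_ * _).
rewrite (bigD1 y) //= eqxx expr1 [X in _ * X]big1 ?mulr1 // => x xy.
by rewrite eq_sym (negbTE xy).
Qed.

(** The multi-index of the monomial of [u], in the format of [hypercontractive_tensor]. Counts are
    at most [M], so [inord] never takes its default value. *)
Definition exponents n M (u : M.-tuple 'I_n) : n.-tuple 'I_M.+1 :=
  [tuple inord (count_mem j u) | j < n].

Lemma tnth_exponents n M (u : M.-tuple 'I_n) j :
  tnth (exponents u) j = count_mem j u :> nat.
Proof.
rewrite tnth_mktuple inordK // ltnS -[X in (_ <= X)%N](size_tuple u).
exact: count_size.
Qed.

Lemma exponents_eq n M (u v : M.-tuple 'I_n) :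
  (exponents u == exponents v) = perm_eq u v.
Proof.
apply/eqP/idP => [E|uv].
  by apply/allP => j _ /=; rewrite -!tnth_exponents E.
apply: eq_from_tnth => j; apply: val_inj.
by rewrite /= !tnth_exponents; exact: (seq.permP uv).
Qed.

(** A nonempty fibre of [exponents] is one rearrangement class, on which [c] is constant. Of the two
    factors of its squared cardinality, one becomes the weight and the other the number of terms. *)
Lemma normc_sqr_sum_exponents (R : rcfType) n M (c : M.-tuple 'I_n -> R[i]) a :
  sym_tuple c ->
  normc (\sum_(u | exponents u == a) c u) ^+ 2 =
  \sum_(u | exponents u == a) (perm_class u)%:R * normc (c u) ^+ 2.
Proof.
move=> cs; have [u0 /eqP au0|h] := pickP [pred u | exponents u == a]; last first.
  by rewrite !big_pred0 // normc0 expr0n.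
have E u : (exponents u == a) = perm_eq u0 u by rewrite -au0 eq_sym exponents_eq.
have card0 : #|[pred u | exponents u == a]| = perm_class u0.
  by apply: eq_card => u; rewrite !inE E.
rewrite (eq_bigr (fun=> c u0)); last by move=> u; rewrite E => /cs ->.
rewrite [RHS](eq_bigr (fun=> (perm_class u0)%:R * normc (c u0) ^+ 2)); last first.
  by move=> u; rewrite E => h; rewrite (perm_class_sym h) (cs _ _ h).
rewrite !sumr_const card0 -[c u0 *+ _]mulr_natl normcM normc_nat exprMn expr2.
by rewrite -[RHS]mulr_natl mulrA.
Qed.

Lemma sum_fibers (V : nmodType) (I J : finType) (f : I -> J) (F : I -> V) :
  \sum_j \sum_(i | f i == j) F i = \sum_i F i.
Proof. by rewrite [RHS](partition_big f xpredT). Qed.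

(** Homogeneity makes every weight of [hypercontractive_tensor] equal to [2^-1 ^+ M], whence the
    factor [Num.sqrt 2 ^+ M]. *)
Lemma sqrt_sum_perm_class_le (R : rcfType) n M N (z : 'I_N -> R[i]) (K : R)
    (c : M.-tuple 'I_n -> R[i]) :
  0 <= K ->
  (forall a : 'I_M.+1 -> R[i],
    Num.sqrt (\sum_k normc (a k) ^+ 2 * 2^-1 ^+ k) <=
    K * (N%:R^-1 * \sum_j normc (\sum_k a k * z j ^+ k))) ->
  sym_tuple c ->
  Num.sqrt (\sum_u (perm_class u)%:R * normc (c u) ^+ 2) <=
  Num.sqrt 2 ^+ M * ((K / N%:R) ^+ n * \sum_(v : n.-tuple 'I_N)
     normc (\sum_u c u * \prod_(x <- u) z (tnth v x))).
Proof.
move=> K0 H cs; pose a t := \sum_(u : M.-tuple 'I_n | exponents u == t) c u.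
have := hypercontractive_tensor K0 H a.
rewrite (eq_bigr (fun t => \sum_(u | exponents u == t)
   2^-1 ^+ M * ((perm_class u)%:R * normc (c u) ^+ 2))); last first.
  move=> t _; rewrite /a normc_sqr_sum_exponents // mulr_suml.
  apply: eq_bigr => u /eqP <-; rewrite mulrC; congr (_ * _).
  rewrite (eq_bigr (fun i => 2^-1 ^+ count_mem i u)) => [|i _].
    by rewrite prod_count big_const_seq iter_mulr_1 count_predT size_tuple.
  by rewrite tnth_exponents.
rewrite sum_fibers -mulr_sumr.
rewrite [X in _ <= _ * X](eq_bigr (fun v : n.-tuple 'I_N =>
    normc (\sum_u c u * \prod_(x <- u) z (tnth v x)))); last first.
  move=> v _; congr normc.
  rewrite -[RHS](sum_fibers (@exponents n M)).
  apply: eq_bigr => t _; rewrite mulr_suml; apply: eq_bigr => u /eqP <-.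
  congr (_ * _); rewrite -(prod_count (fun x => z (tnth v x))).
  by apply: eq_bigr => i _; rewrite tnth_exponents.
have s2 : 0 < Num.sqrt 2 ^+ M :> R by rewrite exprn_gt0 // sqrtr_gt0.
move=> h; rewrite mulrC -ler_pdivrMr //; apply: le_trans h.
rewrite sqrtrM ?exprn_ge0 // mulrC le_eqVlt; apply/orP; left; apply/eqP.
have -> : 2^-1 ^+ M = ((Num.sqrt 2 ^+ M)^-1) ^+ 2 :> R.
  by rewrite !exprVn exprAC sqr_sqrtr.
by rewrite sqrtr_sqr ger0_norm // invr_ge0 ltW.
Qed.

Lemma mixed_norm_sym (R : rcfType) (T : finType) M (b : M.+1.-tuple T -> R) l :
  sym_tuple b -> mixed_norm b l = mixed_norm b ord0.
Proof.
move=> bs; apply: eq_bigr => x _; congr Num.sqrt.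
pose sw (t : M.+1.-tuple T) := [tuple tnth t (tperm ord0 l i) | i < M.+1].
have swK : cancel sw sw.
  move=> t; apply: eq_from_tnth => i.
  by rewrite !tnth_mktuple tpermK.
rewrite (reindex sw) /=; last by exists sw => t _; exact: swK.
apply: eq_big => [t|t _]; first by rewrite tnth_mktuple tpermR.
congr (_ ^+ 2); apply: bs; apply/tuple_permP.
by exists (tperm ord0 l).
Qed.

(** At [s = m] the l^2 factor has exponent 0, and by symmetry the [m] mixed norms coincide. *)
Lemma blei_symmetric (R : realType) (T : finType) M (q : R)
    (b : M.+1.-tuple T -> R) :
  q = (2 * M.+1)%:R / (M.+1 + 1)%:R -> (forall t, 0 <= b t) -> sym_tuple b ->
  \sum_t b t `^ q <= mixed_norm b ord0 `^ q.
Proof.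
move=> qE b0 bs; have MR : M.+1%:R != 0 :> R by rewrite pnatr_eq0.
apply: (le_trans (blei_partial (leqnn _) (ltn0Sn M) qE b0)).
rewrite divff // subrr mulr0 powRr0 mul1r.
under eq_bigr => l _ do rewrite (mixed_norm_sym l bs).
rewrite prodr_const card_ord -powR_mulrn ?powR_ge0 // -powRrM.
by rewrite -mulrA mulVf // mulr1.
Qed.

(** * Homogeneous polynomials *)

(** This stands in for the limit e -> 0: multiply by [(1 - e) ^+ k], then bound that factor below by
    Bernoulli and [((1 - e) * (1 + e)) ^+ k] above by 1. *)
Lemma ler_of_le_mul1D_exp (R : realFieldType) k (x y : R) :
  (forall e, 0 < e -> x <= (1 + e) ^+ k * y) -> x <= y.
Proof.
move=> h; case: k h => [h|k h]; first by have := h 1 ltr01; rewrite expr0 mul1r.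
have [y0|y0] := ltP y 0.
  have : 1 <= (1 + 1) ^+ k.+1 :> R by apply: exprn_ege1; rewrite lerDl.
  by move=> p1; apply: (le_trans (h 1 ltr01)); nra.
have [//|yx] := leP x y; have x0 : 0 < x := le_lt_trans y0 yx.
have kR : 0 < k.+1%:R :> R by rewrite ltr0n.
have bernoulli (e : R) j : 0 <= e -> e <= 1 -> 1 - j%:R * e <= (1 - e) ^+ j.
  move=> e0 e1; elim: j => [|j IHj]; first by rewrite mul0r subr0 expr0.
  rewrite exprS; apply: (@le_trans _ _ ((1 - e) * (1 - j%:R * e))).
    by rewrite -(natr1 j); have : 0 <= j%:R * e * e; [rewrite !mulr_ge0 | lra].
  by rewrite ler_wpM2l // subr_ge0.
pose d := x * k.+1%:R; have d0 : 0 < d by rewrite mulr_gt0.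
(* With this [e] Bernoulli loses exactly half of the gap [x - y], which contradicts [y < x]. *)
pose e := (x - y) / d / 2.
have e0 : 0 < e by rewrite !divr_gt0 // subr_gt0.
have de : d * e = (x - y) / 2 by rewrite /e mulrA mulrCA divff ?mulr1 ?gt_eqF.
have e1 : e <= 1.
  have : x * e <= d * e.
    by rewrite ler_wpM2r ?(ltW e0) // ler_peMr ?(ltW x0) // ler1n.
  rewrite de => xe; rewrite -(ler_pM2l x0) mulr1; lra.
have b := bernoulli e k.+1 (ltW e0) e1.
have e1' : 0 <= (1 - e) ^+ k.+1 by rewrite exprn_ge0 // subr_ge0.
have := ler_wpM2l e1' (h e e0); rewrite mulrA -exprMn => h1.
have h2 : ((1 - e) * (1 + e)) ^+ k.+1 * y <= y.
  by rewrite ler_piMl // exprn_ile1 //; nra.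
have h3 : x * (1 - k.+1%:R * e) <= x * (1 - e) ^+ k.+1 by rewrite ler_wpM2l // ltW.
rewrite mulrBr mulr1 mulrA -/d de in h3; lra.
Qed.

Lemma sum_perm_class (V : nmodType) (T : finType) s (t0 : s.-tuple T)
    (F : s.-tuple T -> V) :
  sym_tuple F -> \sum_(t : s.-tuple T | perm_eq t0 t) F t = F t0 *+ perm_class t0.
Proof.
move=> Fs; rewrite (eq_bigr (fun=> F t0)); last by move=> t /Fs ->.
by rewrite sumr_const; congr (_ *+ _); apply: eq_card => t; rewrite !inE.
Qed.

Lemma sum_count_mem (T : finType) (s : seq T) :
  (\sum_x count_mem x s = size s)%N.
Proof.
elim: s => [|y s IHs]; first by rewrite big1.
rewrite /= big_split /= IHs (bigD1 y) //= eqxx big1 // => x xy.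
by rewrite eq_sym (negbTE xy).
Qed.

(** * Multi-indices as rearrangement classes of tuples *)

Definition tuple_mnm n m (t : m.-tuple 'I_n) : mpoly.multinom n :=
  mpoly.Multinom [tuple count_mem i t | i < n].

Lemma tuple_mnmE n m (t : m.-tuple 'I_n) i : tuple_mnm t i = count_mem i t.
Proof. exact: mpoly.mnmE. Qed.

Lemma mdeg_tuple_mnm n m (t : m.-tuple 'I_n) : mpoly.mdeg (tuple_mnm t) = m.
Proof.
rewrite mpoly.mdegE -[RHS](size_tuple t) -sum_count_mem.
by apply: eq_bigr => i _; rewrite tuple_mnmE.
Qed.

Lemma mdeg_tuple_mnm_lt n m (t : m.-tuple 'I_n) :
  (mpoly.mdeg (tuple_mnm t) < m.+1)%N.
Proof. by rewrite mdeg_tuple_mnm. Qed.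

Definition tuple_bmnm n m (t : m.-tuple 'I_n) : mpoly.bmultinom n m.+1 :=
  mpoly.BMultinom (mdeg_tuple_mnm_lt t).

Lemma tuple_mnm_eq n m (t t' : m.-tuple 'I_n) :
  (tuple_mnm t == tuple_mnm t') = perm_eq t t'.
Proof.
apply/eqP/idP => [E|tt'].
  by apply/allP => i _ /=; rewrite -!tuple_mnmE E.
by apply/mpoly.mnmP => i; rewrite !tuple_mnmE; exact: (seq.permP tt').
Qed.

Lemma tuple_bmnm_eq n m (t t' : m.-tuple 'I_n) :
  (tuple_bmnm t' == tuple_bmnm t) = perm_eq t t'.
Proof. by rewrite -tuple_mnm_eq eq_sym. Qed.

Lemma tuple_mnm_surj n m (a : mpoly.multinom n) :
  mpoly.mdeg a = m -> exists t : m.-tuple 'I_n, tuple_mnm t = a.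
Proof.
move=> am; pose s := flatten [seq nseq (a i) i | i <- index_enum 'I_n].
have cs j : count_mem j s = a j.
  rewrite count_flatten sumnE !big_map (bigD1 j) //= count_nseq /= eqxx.
  rewrite mul1n big1 ?addn0 // => i ij.
  by rewrite count_nseq /= (negbTE ij).
have ss : size s == m.
  rewrite -sum_count_mem -am mpoly.mdegE; apply/eqP.
  by apply: eq_bigr => i _; rewrite cs.
by exists (Tuple ss); apply/mpoly.mnmP => i; rewrite tuple_mnmE cs.
Qed.

(** Each monomial coefficient is shared equally among the rearrangements of [t]; this gives the
    coefficients of the symmetric multilinear form of [p]. *)
Definition sym_coef (R : rcfType) n m (p : mpoly.mpoly n R[i]) (t : m.-tuple 'I_n) :=
  mpoly.mcoeff (tuple_mnm t) p / (perm_class t)%:R.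

Lemma sym_coef_sym (R : rcfType) n m (p : mpoly.mpoly n R[i]) :
  sym_tuple (@sym_coef R n m p).
Proof.
move=> t t' tt'; rewrite /sym_coef (perm_class_sym tt').
by move: tt'; rewrite -tuple_mnm_eq => /eqP ->.
Qed.

Lemma meval_sym_coef (R : rcfType) n m (p : mpoly.mpoly n R[i]) z :
  p \is @mpoly.ishomog1 n R[i] m mpoly.mdeg ->
  mpoly.meval z p = \sum_(t : m.-tuple 'I_n) sym_coef p t * \prod_(x <- t) z x.
Proof.
move=> hp; have sp : (mpoly.msize p <= m.+1)%N.
  rewrite mpoly.mmeasureE; apply/bigmax_leqP_seq => a ap _.
  by rewrite ltnS (mpoly.dhomog_mf hp).
rewrite {1}(mpoly.mpolywE sp) rmorph_sum /= -(sum_fibers (@tuple_bmnm n m)).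
apply: eq_bigr => a _; rewrite mpoly.mevalZ mpoly.mevalX.
have [am|am] := eqVneq (mpoly.mdeg a) m; last first.
  rewrite (mpoly.dhomog_nemf_coeff hp am) mul0r big_pred0 // => t.
  by apply: contraNF am => /eqP <-; rewrite mdeg_tuple_mnm.
have [t ta] := tuple_mnm_surj am.
have {}ta : tuple_bmnm t = a by exact: val_inj.
rewrite [RHS](eq_bigl (fun t' : m.-tuple 'I_n => perm_eq t t')); last first.
  by move=> t'; rewrite -ta tuple_bmnm_eq.
rewrite sum_perm_class => [|t1 t2 tt]; last first.
  by rewrite (sym_coef_sym p tt) (perm_big _ tt).
rewrite -ta /sym_coef -[RHS]mulr_natr [RHS]mulrAC divfK; last first.
  by rewrite pnatr_eq0 -lt0n perm_class_gt0.
rewrite -(prod_count z); congr (_ * _); apply: eq_bigr => i _.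
by rewrite tuple_mnmE.
Qed.

(** Scaling by 1/((1 + e) r) moves [z] into the open polydisc, homogeneity restores the factor, and
    [e] tends to 0. *)
Lemma meval_le_polydisc_sup (R : realType) n m (p : mpoly.mpoly n R[i]) (r : R) z :
  p \is @mpoly.ishomog1 n R[i] m mpoly.mdeg -> 0 < r ->
  (forall x, normc (z x) <= r) ->
  normc (mpoly.meval z p) <= r ^+ m * polydisc_sup p.
Proof.
move=> hp r0 zr; apply: (@ler_of_le_mul1D_exp _ m) => e e0.
pose d := (1 + e) * r; have d0 : 0 < d by rewrite mulr_gt0 // addr_gt0.
pose y x := (d^-1)%:C * z x.
have yD : polydisc R n y.
  move=> x; rewrite /y normcM normc_real ger0_norm ?invr_ge0 ?(ltW d0) //.
  rewrite mulrC ltr_pdivrMr // mul1r; apply: (le_lt_trans (zr x)).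
  by rewrite /d ltr_pMl // ltrDl.
have E : mpoly.meval z p = (d ^+ m)%:C * mpoly.meval y p.
  rewrite !(meval_sym_coef _ hp) mulr_sumr; apply: eq_bigr => t _.
  rewrite mulrCA; congr (_ * _); rewrite big_split /= big_const_seq count_predT.
  rewrite iter_mulr_1 size_tuple mulrA -rmorphXn -rmorphM /= exprVn divff ?mul1r //.
  by rewrite expf_neq0 // gt_eqF.
rewrite E normcM normc_real ger0_norm ?exprn_ge0 ?(ltW d0) //.
rewrite mulrA -exprMn -/d ler_wpM2l ?exprn_ge0 ?(ltW d0) //.
apply: ub_le_sup; last by exists y.
(* This upper bound ensures that [sup] is a true supremum. *)
exists (\sum_(t : m.-tuple 'I_n) normc (sym_coef p t)) => _ [v vD <-].
rewrite (meval_sym_coef _ hp); apply: (le_trans (normc_sum _ _)).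
apply: ler_sum => t _; rewrite normcM ler_piMr ?normc_ge0 // normc_prod.
rewrite prodr_ile1 // => x _; rewrite normc_ge0 /= ltW //.
Qed.

(** A class of [N] tuples sharing the coefficient [A] contributes N^(1 - q/2) A^q, and the power of
    [N] is at least 1 because [q <= 2]. *)
Lemma powR_le_fiber (R : realType) (N A q : R) :
  1 <= N -> 0 <= A -> 0 <= q -> q <= 2 ->
  A `^ q <= N * (Num.sqrt N * (A / N)) `^ q.
Proof.
move=> N1 A0 q0 q2; set Y := Num.sqrt N.
have Y1 : 1 <= Y by rewrite -[1]sqrtr1 ler_wsqrtr.
have Y0 : 0 < Y := lt_le_trans ltr01 Y1.
have NE : N = Y ^+ 2 by rewrite sqr_sqrtr // (le_trans ler01).
have -> : Y * (A / N) = Y^-1 * A by rewrite NE; field; rewrite gt_eqF.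
rewrite powRM ?invr_ge0 ?(ltW Y0) // mulrA ler_peMl ?powR_ge0 //.
rewrite -(powR_inv1 (ltW Y0)) -powRrM mulN1r powRN ler_pdivlMr ?powR_gt0 //.
by rewrite mul1r NE -powR_mulrn ?(ltW Y0) // ler_powR.
Qed.

Definition class_coef (R : realType) n m (p : mpoly.mpoly n R[i])
    (t : m.-tuple 'I_n) : R :=
  Num.sqrt (perm_class t)%:R * normc (sym_coef p t).

Lemma sum_mcoeff_powR_le (R : realType) n M (p : mpoly.mpoly n R[i]) (q : R) :
  0 <= q -> q <= 2 ->
  \sum_(a : mpoly.bmultinom n M.+2 | mpoly.mdeg a == M.+1)
    normc (mpoly.mcoeff a p) `^ q <= \sum_(t : M.+1.-tuple 'I_n) class_coef p t `^ q.
Proof.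
move=> q0 q2.
rewrite -(sum_fibers (@tuple_bmnm n M.+1)) big_mkcond /=.
apply: ler_sum => a _; case: eqP => [am|_]; last first.
  by apply: sumr_ge0 => t _; exact: powR_ge0.
have [t ta] := tuple_mnm_surj am.
have {}ta : tuple_bmnm t = a by exact: val_inj.
rewrite (eq_bigl (fun t' : M.+1.-tuple 'I_n => perm_eq t t')); last first.
  by move=> t'; rewrite -ta tuple_bmnm_eq.
rewrite sum_perm_class => [|t1 t2 tt]; last first.
  by rewrite /class_coef (perm_class_sym tt) (sym_coef_sym p tt).
rewrite -ta -[leRHS]mulr_natl /class_coef /sym_coef normcM normcV normc_nat.
by apply: powR_le_fiber; rewrite ?normc_ge0 // ler1n perm_class_gt0.
Qed.

Lemma mixed_norm_class_coef_le (R : realType) n M (p : mpoly.mpoly n R[i]) :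
  (0 < M)%N -> p \is @mpoly.ishomog1 n R[i] M.+1 mpoly.mdeg ->
  mixed_norm (@class_coef R n M.+1 p) ord0 <=
  Num.sqrt M.+1%:R * Num.sqrt 2 ^+ M *
  ((1 + 1 / M%:R) ^+ M * polydisc_sup p).
Proof.
(* Each of the [n] variables costs one factor [1 + e]. *)
move=> M0 hp; apply: (@ler_of_le_mul1D_exp _ n) => e e0.
have [N [w [wP wH]]] := hypercontractive1 M.+1 e0.
pose z (j : 'I_N) := w ^+ j.
have H (a : 'I_M.+1 -> R[i]) : Num.sqrt (\sum_k normc (a k) ^+ 2 * 2^-1 ^+ k) <=
    (1 + e) * (N%:R^-1 * \sum_j normc (\sum_k a k * z j ^+ k)).
  have := wH (\poly_(k < M.+1) a (inord k)) (size_poly _ _).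
  under eq_bigr => k _ do rewrite coef_poly ltn_ord inord_val.
  under [X in _ <= _ * (_ * X)]eq_bigr => j _.
    rewrite horner_poly.
    under eq_bigr => k _ do rewrite inord_val.
    over.
  by [].
have e1 : 0 <= 1 + e by rewrite addr_ge0 // ltW.
pose P k (y : 'I_n -> R[i]) := \sum_(u : M.-tuple 'I_n)
  sym_coef p [tuple of k :: u] * \prod_(x <- u) y x.
have Pb (v : n.-tuple 'I_N) : \sum_k normc (P k (fun x => z (tnth v x))) <=
    (1 + 1 / M%:R) ^+ M * polydisc_sup p.
  apply: polarization_bound => //; first exact: sym_coef_sym.
    by move=> r y r0 yr; rewrite -(meval_sym_coef _ hp) meval_le_polydisc_sup.
  by move=> x; rewrite /z normcX (normc_prim_root wP) expr1n.
rewrite mixed_norm_ord0.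
apply: (@le_trans _ _ (\sum_k Num.sqrt M.+1%:R * (Num.sqrt 2 ^+ M *
    (((1 + e) / N%:R) ^+ n * \sum_(v : n.-tuple 'I_N)
      normc (P k (fun x => z (tnth v x))))))).
  apply: ler_sum => k _.
  have ck := sym_tuple_cons k (@sym_coef_sym _ _ M.+1 p).
  have L := sqrt_sum_perm_class_le e1 H ck.
  (* Replacing the class of [k :: u] by that of [u] costs at most [M.+1] under the root: the factor
     [Num.sqrt m%:R] of the theorem. *)
  apply: le_trans (ler_wpM2l (sqrtr_ge0 M.+1%:R) L).
  rewrite -sqrtrM ?ler0n // ler_wsqrtr // mulr_sumr; apply: ler_sum => u _.
  rewrite /class_coef exprMn sqr_sqrtr ?ler0n // [leRHS]mulrA ler_wpM2r ?sqr_ge0 //.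
  by rewrite -natrM ler_nat perm_class_cons.
(* The sum over [k] moves inside the mean over the [N ^ n] grid points, where [Pb] bounds it at
   every point. *)
rewrite -!mulr_sumr exchange_big /= [leRHS]mulrCA -[leRHS]mulrA.
rewrite ler_wpM2l ?sqrtr_ge0 // ler_wpM2l ?exprn_ge0 ?sqrtr_ge0 //.
rewrite expr_div_n -mulrA ler_wpM2l ?exprn_ge0 //.
rewrite mulrC ler_pdivrMr; last by rewrite -natrX ltr0n expn_gt0 (prim_order_gt0 wP).
apply: (le_trans (ler_sum _ (fun v _ => Pb v))).
by rewrite sumr_const card_tuple card_ord -natrX mulr_natr.
Qed.

Lemma sum_mcoeff_powR_le_mixed_norm (R : realType) n M (p : mpoly.mpoly n R[i]) :
  (\sum_(a : mpoly.bmultinom n M.+2 | mpoly.mdeg a == M.+1)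
     normc (mpoly.mcoeff a p) `^ ((2 * M.+1)%:R / (M.+1 + 1)%:R))
    `^ ((M.+1 + 1)%:R / (2 * M.+1)%:R) <=
  mixed_norm (@class_coef R n M.+1 p) ord0.
Proof.
set q := (2 * M.+1)%:R / (M.+1 + 1)%:R.
have q0 : 0 <= q by rewrite divr_ge0.
have q2 : q <= 2.
  by rewrite /q addn1 ler_pdivrMr ?ltr0n // -natrM ler_nat leq_mul2l leqnSn.
have bs : sym_tuple (@class_coef R n M.+1 p).
  by move=> t t' tt'; rewrite /class_coef (perm_class_sym tt') (sym_coef_sym p tt').
have b0 (t : M.+1.-tuple 'I_n) : 0 <= class_coef p t.
  by rewrite mulr_ge0 ?sqrtr_ge0 ?normc_ge0.
have h := le_trans (sum_mcoeff_powR_le M p q0 q2) (blei_symmetric (erefl q) b0 bs).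
rewrite -[leRHS]powRr1 ?mixed_norm_ge0 //.
rewrite [X in _ <= _ `^ X](_ : 1 = q * ((M.+1 + 1)%:R / (2 * M.+1)%:R)); last first.
  by rewrite /q mulf_div [X in X / _]mulrC divff // mulf_neq0 // pnatr_eq0 ?addn1.
rewrite [leRHS]powRrM ge0_ler_powR ?nnegrE ?powR_ge0 ?divr_ge0 //.
by apply: sumr_ge0 => a _; exact: powR_ge0.
Qed.

Theorem theorem1 (R : realType) (m n : nat) (hm : (1 < m)%N) (hn : (1 < n)%N)
    (p : mpoly.mpoly n R[i])
    (hp : p \is @mpoly.ishomog1 n R[i] m mpoly.mdeg) :
  (\sum_(alpha : mpoly.bmultinom n m.+1 | mpoly.mdeg alpha == m)
     Normc.normc (mpoly.mcoeff alpha p) `^ ((2 * m)%:R / (m + 1)%:R))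
    `^ ((m + 1)%:R / (2 * m)%:R)
  <= (1 + 1 / (m%:R - 1)) ^+ (m - 1) * Num.sqrt m%:R * Num.sqrt 2 ^+ (m - 1)
     * polydisc_sup p.
Proof.
case: m hm hp => [//|M]; rewrite ltnS => M0 hp.
apply: (le_trans (sum_mcoeff_powR_le_mixed_norm _ p)).
apply: (le_trans (mixed_norm_class_coef_le M0 hp)).
rewrite subSS subn0 -[in leRHS](natr1 M) addrK natr1 le_eqVlt; apply/orP; left; apply/eqP.
by ring.
Qed.
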